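(* Let $M\in\mathbb{N}$, $\mathcal{I}=\{1,\dots,M\}$, let $\{A_1,\dots,A_M\}\subset\mathbb{R}^{n\times n}$, $\rho>0$ and $\tau_2\ge\tau_1\ge0$. Suppose there exist symmetric positive definite matrices $P_1^+,P_1^-,\dots,P_M^+,P_M^-\succ0$ in $\mathbb{R}^{n\times n}$, $\mu\in(0,1)$ and $\nu\in\mathbb{R}$ such that (a) $P_i^+\preceq\mu^2P_i^-$ for all $i\in\mathcal{I}$; (b) $A_i^\top P_i^++P_i^+A_i\preceq2\nu P_i^+$ for all $i\in\mathcal{I}$; (c) $\log(\mu)+(\tau_2-\tau_1)(\nu+\rho)\le0$; (d) $e^{A_i^\top\tau_1}P_j^-e^{A_i\tau_1}\preceq e^{-2\rho\tau_1}P_i^+$ for all $i,j\in\mathcal{I}$ with $i\ne j$. Then the switched linear system $\dot x(t)=A_{\sigma(t)}x(t)$ is $\rho$-UES on $\mathcal{S}_{\mathrm{dw}}(\tau_1,\tau_2)$. Moreover, if $\tau_1>0$, the same conclusion holds if condition (d) is replaced by the following: given $K\in\mathbb{N}$, $K\ge1$, for every $i,j\in\mathcal{I}$ with $i\neq j$ there exist symmetric positive definite matrices $Q_{ij,0},\dots,Q_{ij,K}\succ0$ such that $Q_{ij,0}=P_i^+$, $Q_{ij,K}=P_j^-$ and, for all $k\in\{1,\dots,K\}$, $$A_i^\top Q_{ij,k}+Q_{ij,k}A_i+\frac{K(Q_{ij,k}-Q_{ij,k-1})}{\tau_1}\prec-2\rho\,Q_{ij,k},$$ $$A_i^\top Q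_{ij,k-1}+Q_{ij,k-1}A_i+\frac{K(Q_{ij,k}-Q_{ij,k-1})}{\tau_1}\prec-2\rho\,Q_{ij,k-1}.$$
   Context: $\mathbb{R}_+=[0,\infty)$. $\preceq$, $\prec$, $\succ$ denote the usual (Loewner) order on symmetric matrices. $\mathcal{S}$ is the set of piecewise constant, right-continuous signals $\sigma:\mathbb{R}_+\to\mathcal{I}$. For $\sigma\in\mathcal{S}$, set $t_0^\sigma=0$ and let $t_1^\sigma<t_2^\sigma<\cdots$ be the positive times at which $\sigma$ is discontinuous (switching instants); if there are infinitely many, they are unbounded. $\mathcal{S}_{\mathrm{dw}}(\tau_1,\tau_2)$ is the set of $\sigma\in\mathcal{S}$ having infinitely many switching instants and satisfying $\tau_1\le t_k^\sigma-t_{k-1}^\sigma\le\tau_2$ for all $k\ge1$. $\Phi_\sigma(t,x)$ denotes the solution at time $t\ge0$ of $\dot x(t)=A_{\sigma(t)}x(t)$ with initial condition $x\in\mathbb{R}^n$ at time $0$. For $\rho>0$, the system is uniformly exponentially stable with decay $\rho$ on $\widetilde{\mathcal{S}}\subseteq\mathcal{S}$ ($\rho$-UES) if there is $C\ge0$ such that $|\Phi_\sigma(t,x)|\le Ce^{-\rho t}|x|$ for all $\sigma\in\widetilde{\mathcal{S}}$, $x\in\mathbb{R}^n$, $t\in\mathbb{R}_+$. *)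

(* Defs.v *)
From mathcomp Require Export all_boot all_order all_algebra.
From mathcomp Require Export all_classical all_reals all_analysis.

Set Implicit Arguments.
Unset Strict Implicit.
Unset Printing Implicit Defensive.

Export Order.TTheory GRing.Theory Num.Theory.
Export numFieldNormedType.Exports.

Local Open Scope classical_set_scope.
Local Open Scope ring_scope.

Section Matrices.
Context {R : realType} {n : nat}.
Implicit Types (A B P : 'M[R]_n) (x : 'cV[R]_n).

Definition posdefmx P : Prop :=
  P^T = P /\ forall x, x != 0 -> 0 < (x^T *m P *m x) 0 0.

Definition possemidefmx P : Prop :=
  P^T = P /\ forall x, 0 <= (x^T *m P *m x) 0 0.

Definition loewner_le A B : Prop := possemidefmx (B - A).
Definition loewner_lt A B : Prop := posdefmx (B - A).

Definition expmx A : 'M[R]_n :=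
  limn (series (fun k => (k`!%:R)^-1 *: A ^+ k)).

(* The norm `|x| that MathComp-Analysis puts on matrices is the sup norm. *)
Definition enorm x : R := Num.sqrt (\sum_i x i 0 ^+ 2).

End Matrices.

(* A signal is a function on all of R of which only the restriction to [0, +oo[
   is ever used; 'I_M plays the role of {1, ..., M}. Since 'I_M is discrete,
   continuity of a signal at a point means being constant near that point. *)
Section Signals.
Context {R : realType} {M : nat}.
Implicit Types (sigma : R -> 'I_M).

Definition switching_instants sigma : set R :=
  [set t : R | 0 < t /\ ~ (\forall s \near t, sigma s = sigma t)].

(* Piecewise constant: finitely many discontinuities in every bounded interval.
   In particular, infinitely many switching instants are unbounded. *)
Definition signals : set (R -> 'I_M) :=
  [set sigma |
    (forall t : R, 0 <= t -> \forall s \near t^'+, sigma s = sigma t) /\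
    (forall T : R, finite_set (switching_instants sigma `&` [set t | t <= T]))].

(* The sequence t enumerates increasingly 0 = t 0 and then all the switching
   instants; that such an infinite sequence exists says that there are
   infinitely many of them. *)
Definition dwell_signals (tau1 tau2 : R) : set (R -> 'I_M) :=
  [set sigma | signals sigma /\
    exists t : nat -> R,
      [/\ t 0%N = 0,
          (forall k, t k < t k.+1),
          range (fun k => t k.+1) = switching_instants sigma &
          forall k, tau1 <= t k.+1 - t k <= tau2]].

End Signals.

Section SwitchedSystem.
Context {R : realType} {M n : nat}.
Variable A : 'I_M -> 'M[R]_n.

(* phi is the trajectory t |-> Phi_sigma(t, x): continuous on [0, +oo[ and
   satisfying the differential equation away from the switching instants. *)
Definition is_trajectory (sigma : R -> 'I_M) (x : 'cV[R]_n)
    (phi : R -> 'cV[R]_n) : Prop :=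
  [/\ phi 0 = x,
      {within `[0, +oo[, continuous phi} &
      forall t : R, 0 < t -> ~ switching_instants sigma t ->
        is_derive t 1 phi (A (sigma t) *m phi t)].

Definition UES (rho : R) (S : set (R -> 'I_M)) : Prop :=
  exists2 C : R, 0 <= C &
    forall (sigma : R -> 'I_M) (x : 'cV[R]_n) (phi : R -> 'cV[R]_n),
      S sigma -> is_trajectory sigma x phi ->
      forall t : R, 0 <= t -> enorm (phi t) <= C * expR (- rho * t) * enorm x.

End SwitchedSystem.

(* Main.v *)
Require Import Defs.
From mathcomp Require Import ring lra.

(** The proof exhibits a Lyapunov function that changes with the phase of the
signal. Let [sigma] switch at the times [t k], and let [i] be its mode from
[t k] to [t k.+1]. At the time [t k] measure the state by the form [Pm i].
Passing there to the form [Pp i] gains a factor [mu ^+ 2], by [ha]. Up to the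
time [t k.+1 - tau1] the form [Pp i] grows at most at rate [2 * nu], by [hb].
During the last [tau1] units of time, the inequalities relating [Pp i] to
[Pm j], where [j] is the next mode, lead from the former form to the latter
with a decay at rate [2 * rho]. By [hc] the gain [mu ^+ 2] compensates the
growth during the middle phase, so altogether the form decays at rate
[2 * rho] from one switching instant to the next ([dwell_step]). Since dwell
intervals have length at most [tau2] and all forms are equivalent to the
squared Euclidean norm, this gives the exponential bound at all times
([UES_exit_decay]). The argument relies on successive modes being different
([signal_jump]), as [Pp i] is compared with [Pm j] only for distinct modes, and
on the switching instants being unbounded ([dwell_cover]).

The two alternative hypotheses of the theorem both enter only through their
consequence [exit_decay] for solutions of [y' = A i y] on an interval of length
[tau1]. For the condition on matrix exponentials this rests on the identity
[y (a + tau1) = expmx (tau1 *: A i) *m y a] ([solves_on_expmx]), a Taylor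
expansion of [y]. For the condition on the matrices [Q k], their piecewise
affine interpolation serves as a time dependent quadratic form: on each piece
the Lyapunov inequality is a convex combination of the two inequalities at the
ends ([lyapunov_decay_segment]). *)

Set Implicit Arguments.
Unset Strict Implicit.
Unset Printing Implicit Defensive.

Local Open Scope classical_set_scope.
Local Open Scope ring_scope.

(** * Limits and derivatives of matrix-valued functions *)

Section MatrixCalculus.
Context {R : realType}.

(** Valid because the norm of matrices is the sup norm; it reduces the limits of
matrices below to limits of real numbers. *)
Lemma cvg_mxP (T : Type) (F : set_system T) {FF : Filter F} m n
    (f : T -> 'M[R]_(m, n)) (L : 'M[R]_(m, n)) :
  f @ F --> L <-> forall i j, (fun x => f x i j) @ F --> L i j.
Proof.
split=> [fL i j|fL]; first exact: cvg_comp fL (@coord_continuous _ _ _ i j L).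
apply/cvgrPdist_le => /= e e0; near=> x.
rewrite /Num.Def.normr/= mx_normrE (bigmax_le _ (ltW e0))//= => i _.
rewrite !mxE/=; move: i; near: x; apply: filter_forall => /= i.
exact: ((cvgrPdist_le _ _).1 (fL i.1 i.2)).
Unshelve. all: by end_near. Qed.

Lemma cvg_mulmx (T : Type) (F : set_system T) {FF : Filter F} m n p
    (f : T -> 'M[R]_(m, n)) (g : T -> 'M[R]_(n, p))
    (L : 'M[R]_(m, n)) (N : 'M[R]_(n, p)) :
  f @ F --> L -> g @ F --> N -> (fun x => f x *m g x) @ F --> L *m N.
Proof.
move=> /cvg_mxP fL /cvg_mxP gN; apply/cvg_mxP => i j.
under eq_fun do rewrite mxE.
rewrite mxE; apply: cvg_big => [|k _]; first exact: add_continuous.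
exact: cvgM.
Qed.

Lemma cvg_trmx (T : Type) (F : set_system T) {FF : Filter F} m n
    (f : T -> 'M[R]_(m, n)) (L : 'M[R]_(m, n)) :
  f @ F --> L -> (fun x => (f x)^T) @ F --> L^T.
Proof.
move=> /cvg_mxP fL; apply/cvg_mxP => i j.
under eq_fun do rewrite mxE; rewrite mxE; exact: fL.
Qed.

Lemma is_derive_mxP m n (f : R -> 'M[R]_(m, n)) (t v : R) (df : 'M[R]_(m, n)) :
  is_derive t v f df <-> forall i j, is_derive t v (fun x => f x i j) (df i j).
Proof.
split=> [[fd <-] i j|fd].
  apply: DeriveDef; first by move/derivable_mxP : fd; exact.
  by rewrite derive_mx// mxE.
have fd' : derivable f t v.
  by apply/derivable_mxP => i j; have [] := fd i j.
apply: DeriveDef => //; rewrite derive_mx//; apply/matrixP => i j.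
by rewrite mxE; have [_ ->] := fd i j.
Qed.

(** Leibniz rule, obtained entrywise from the rule for a sum of products. *)
Lemma is_derive_mulmx m n p (f : R -> 'M[R]_(m, n)) (g : R -> 'M[R]_(n, p))
    (t v : R) (df : 'M[R]_(m, n)) (dg : 'M[R]_(n, p)) :
  is_derive t v f df -> is_derive t v g dg ->
  is_derive t v (fun x => f x *m g x) (df *m g t + f t *m dg).
Proof.
move=> /is_derive_mxP fd /is_derive_mxP gd; apply/is_derive_mxP => i j.
have -> : (fun x => (f x *m g x) i j)
    = \sum_(k < n) ((fun x => f x i k) * (fun x => g x k j)).
  by apply/funext => x; rewrite mxE fct_sumE.
apply: (is_derive_eq (is_derive_sum (fun k => is_deriveM (fd i k) (gd k j)))).
rewrite !mxE -big_split/=; apply: eq_bigr => k _.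
by rewrite /GRing.scale/=; ring.
Qed.

Lemma is_derive_trmx m n (f : R -> 'M[R]_(m, n)) (t v : R) (df : 'M[R]_(m, n)) :
  is_derive t v f df -> is_derive t v (fun x => (f x)^T) df^T.
Proof.
move=> /is_derive_mxP fd; apply/is_derive_mxP => i j.
under eq_fun do rewrite mxE; rewrite mxE; exact: fd.
Qed.

End MatrixCalculus.

(** * Quadratic forms along linear differential equations *)

Section Lyapunov.
Context {R : realType} {n : nat}.
Implicit Types (A P Q : 'M[R]_n) (x : 'cV[R]_n) (y : R -> 'cV[R]_n).

Definition qform P x : R := (x^T *m P *m x) 0 0.

(** The differential equation is required only in the open interval, because a
trajectory need not be differentiable at the switching instants, where the
dwell intervals end. *)
Definition solves_on A (a b : R) y :=
  {within `[a, b], continuous y} /\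
  forall t, t \in `]a, b[ -> is_derive t 1 y (A *m y t).

Lemma solves_onW A (a b c d : R) y : a <= c -> d <= b ->
  solves_on A a b y -> solves_on A c d y.
Proof.
move=> ac db [yc yd]; split.
  by apply: continuous_subspaceW yc; apply: subset_itv; rewrite bnd_simp.
move=> t; rewrite in_itv/= => /andP[ct td]; apply: yd; rewrite in_itv/=.
by rewrite (le_lt_trans ac ct) (lt_le_trans td db).
Qed.

(** The function [t |-> expR (- c * (t - a)) * f t] has a nonpositive derivative,
hence does not increase. *)
Lemma gronwall_le (f df : R -> R) (c a b : R) : a <= b ->
  {within `[a, b], continuous f} ->
  (forall t, t \in `]a, b[ -> is_derive t 1 f (df t)) ->
  (forall t, t \in `]a, b[ -> df t <= c * f t) ->
  f b <= expR (c * (b - a)) * f a.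
Proof.
move=> ab cf fd dfle.
pose g t := expR (- c * (t - a)) * f t.
have ed (t : R) : is_derive t 1 (fun t => expR (- c * (t - a)))
    (- c * expR (- c * (t - a))).
  have H : is_derive t 1 (fun t => - c * (t - a)) (- c).
    apply: (@is_derive_eq _ _ _ ((- c) \*: (id - cst a)) t 1 _ _ _).
    by rewrite subr0 /GRing.scale/= mulr1.
  by have := @is_derive1_comp _ expR _ t _ _ (is_derive_expR _) H; rewrite mulrC.
have gd t : t \in `]a, b[ ->
    is_derive t 1 g (expR (- c * (t - a)) * (df t - c * f t)).
  move=> /fd ?; have := is_deriveM (ed t) _.
  move=> /(_ f _ _) H; apply: is_derive_eq.
  by rewrite /GRing.scale/=; ring.
have gc : {within `[a, b], continuous g}.
  move=> x; apply: (@continuousM _ (subspace `[a, b])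
    (fun t => expR (- c * (t - a))) f x _ (cf x)).
  apply: continuous_subspaceT => {}x; apply: differentiable_continuous.
  by apply/derivable1_diffP; have [] := ed x.
have : g b <= g a.
  have gdr t : t \in `]a, b[ -> derivable g t 1 by move=> /gd[].
  have g'le0 t : t \in `]a, b[ -> derive1 g t <= 0.
    move=> tab; have [_] := gd _ tab; rewrite derive1E => ->.
    by rewrite mulr_ge0_le0 ?expR_ge0// subr_le0 dfle.
  have g_noninc := ler0_derive1_le_cc gdr g'le0 gc.
  by apply: g_noninc => //; rewrite in_itv/= lexx ab.
rewrite /g subrr mulr0 expR0 mul1r mulNr expRN mulrC ler_pdivrMr ?expR_gt0//.
by rewrite mulrC.
Qed.

Lemma qformD P Q x : qform (P + Q) x = qform P x + qform Q x.
Proof. by rewrite /qform mulmxDr mulmxDl mxE. Qed.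

Lemma qformZ c P x : qform (c *: P) x = c * qform P x.
Proof. by rewrite /qform -scalemxAr -scalemxAl mxE. Qed.

Lemma qformB P Q x : qform (P - Q) x = qform P x - qform Q x.
Proof. by rewrite qformD -scaleN1r qformZ mulN1r. Qed.

Lemma qform_conj P (B : 'M[R]_n) x : qform (B^T *m P *m B) x = qform P (B *m x).
Proof. by rewrite /qform trmx_mul !mulmxA. Qed.

Lemma loewner_le_qform P Q x : loewner_le P Q -> qform P x <= qform Q x.
Proof. by move=> [_ /(_ x)]; rewrite -/(qform _ _) qformB subr_ge0. Qed.

Lemma loewner_lt_le P Q : loewner_lt P Q -> loewner_le P Q.
Proof.
move=> [PQ PQ0]; split=> // x; have [->|/PQ0/ltW//] := eqVneq x 0.
by rewrite mulmx0 mxE.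
Qed.

(** Along [y' = A y] the form [qform (P t) (y t)] has derivative
[qform (A^T P t + P t A + dP t) (y t)], so the matrix inequality is exactly the
differential inequality of [gronwall_le]. *)
Lemma lyapunov_decay A (P dP : R -> 'M[R]_n) y (c a b : R) : a <= b ->
  solves_on A a b y ->
  {within `[a, b], continuous P} ->
  (forall t, t \in `]a, b[ -> is_derive t 1 P (dP t)) ->
  (forall t, t \in `]a, b[ ->
     loewner_le (A^T *m P t + P t *m A + dP t) (c *: P t)) ->
  qform (P b) (y b) <= expR (c * (b - a)) * qform (P a) (y a).
Proof.
move=> ab [yc yd] Pc Pd lmi.
pose V t := (y t)^T *m P t *m y t.
have Vc : {within `[a, b], continuous V}.
  move=> t; apply: cvg_mulmx (yc t); apply: cvg_mulmx (Pc t).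
  exact: cvg_trmx (yc t).
have Vd t : t \in `]a, b[ -> is_derive t 1 V
   ((y t)^T *m (A^T *m P t + P t *m A + dP t) *m y t).
  move=> tab; have yt := yd t tab; have Pt := Pd t tab.
  have H := is_derive_mulmx (is_derive_mulmx (is_derive_trmx yt) Pt) yt.
  apply: (is_derive_eq H).
  by rewrite trmx_mul !mulmxDr !mulmxDl !mulmxA addrAC.
have [cV dV] : {within `[a, b], continuous (fun t => V t 0 0)} /\
    forall t, t \in `]a, b[ -> is_derive t 1 (fun t => V t 0 0)
      (qform (A^T *m P t + P t *m A + dP t) (y t)).
  split=> [t|t /Vd]; first by have /cvg_mxP := Vc t; exact.
  by move=> /is_derive_mxP/(_ 0 0).
apply: (gronwall_le (f := fun t => V t 0 0) ab cV dV) => t /lmi /loewner_le_qform.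
by move=> /(_ (y t)); rewrite qformZ.
Qed.

Lemma lyapunov_decay_cst A P y (c a b : R) : a <= b -> solves_on A a b y ->
  loewner_le (A^T *m P + P *m A) (c *: P) ->
  qform P (y b) <= expR (c * (b - a)) * qform P (y a).
Proof.
move=> ab yab lmi.
apply: (@lyapunov_decay A (fun=> P) (fun=> 0) _ _ _ _ ab yab) => [t|t _].
- exact: cvg_cst.
- by rewrite addr0.
Qed.

Lemma loewner_le_convex P Q P' Q' (l : R) : 0 <= l <= 1 ->
  loewner_le P P' -> loewner_le Q Q' ->
  loewner_le ((1 - l) *: P + l *: Q) ((1 - l) *: P' + l *: Q').
Proof.
move=> /andP[l0 l1] [sP pP] [sQ pQ]; rewrite /loewner_le.
have -> : (1 - l) *: P' + l *: Q' - ((1 - l) *: P + l *: Q)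
   = (1 - l) *: (P' - P) + l *: (Q' - Q).
  by rewrite !scalerBr opprD addrACA.
split=> [|x]; first by rewrite linearD/= 2!linearZ/= sP sQ.
by rewrite -/(qform _ _) qformD !qformZ addr_ge0// mulr_ge0 ?subr_ge0 ?pP ?pQ.
Qed.

(** Take for the moving form the affine interpolation of [P] and [Q]. Its
derivative is constant, so the matrix inequality to be checked at time [t] is
affine in the interpolation parameter: it is a convex combination of the two
inequalities assumed at the ends. *)
Lemma lyapunov_decay_segment A P Q y (c a b : R) : a < b ->
  solves_on A a b y ->
  loewner_le (A^T *m P + P *m A + (b - a)^-1 *: (Q - P)) (c *: P) ->
  loewner_le (A^T *m Q + Q *m A + (b - a)^-1 *: (Q - P)) (c *: Q) ->
  qform Q (y b) <= expR (c * (b - a)) * qform P (y a).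
Proof.
move=> ab yab lP lQ.
have ba0 : b - a != 0 by rewrite subr_eq0 gt_eqF.
pose l (t : R) : R := (t - a) / (b - a).
pose S (t : R) : 'M[R]_n := (1 - l t) *: P + l t *: Q.
have ld (t : R) : is_derive t 1 l (b - a)^-1.
  have -> : l = (b - a)^-1 \*: (id - cst a).
    by apply/funext => x; rewrite /l mulrC.
  apply: is_derive_eq.
  by rewrite subr0 /GRing.scale/= mulr1.
have Sd (t : R) : is_derive t 1 S ((b - a)^-1 *: (Q - P)).
  apply/is_derive_mxP => i j.
  have -> : (fun u => S u i j) = cst (P i j) + (Q i j - P i j) \*: l.
    apply/funext => u; rewrite !mxE/=.
    by change ((1 - l u) * P i j + l u * Q i j = P i j + (Q i j - P i j) * l u); ring.
  apply: is_derive_eq.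
  by rewrite !mxE /GRing.scale/= add0r mulrC.
have -> : Q = S b by rewrite /S /l divff// subrr scale0r scale1r add0r.
have -> : P = S a by rewrite /S /l subrr mul0r subr0 scale0r scale1r addr0.
apply: (@lyapunov_decay A S (fun=> (b - a)^-1 *: (Q - P)) _ _ _ _ (ltW ab)) => //.
  apply: continuous_subspaceT => t; apply: differentiable_continuous.
  by apply/derivable1_diffP; have [] := Sd t.
move=> t; rewrite in_itv/= => /andP[at_ tb].
have l01 : 0 <= l t <= 1.
  rewrite /l ler_pdivrMr ?subr_gt0// mul1r lerD2r (ltW tb) andbT.
  by rewrite divr_ge0 ?subr_ge0// ltW.
have := loewner_le_convex l01 lP lQ.
set D := _ *: (Q - P); congr loewner_le; rewrite /S.
  rewrite !scalerDr !mulmxDr !mulmxDl -!scalemxAr -!scalemxAl.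
  by rewrite addrACA -[_ *: D + _]scalerDl subrK scale1r [in LHS]addrACA.
by rewrite scalerDr !scalerA mulrC [in X in _ + X]mulrC.
Qed.

End Lyapunov.

(** * The matrix exponential as a flow *)

Section Taylor.
Context {R : realType}.

(** Taylor's formula at the far end point, for functions each of which is the
derivative of the preceding one. The Taylor polynomial [F N] of [z 0] centred at
the moving point [t] equals [z 0 b] for [t = b], is the wanted partial sum for
[t = a], and its derivative telescopes to a single term; the mean value
theorem then bounds the remainder by a multiple of [((b - a) * c) ^+ N / N!]. *)
Lemma cvg_taylor (z : nat -> R -> R) (a b B c : R) : a <= b -> 0 <= c ->
  (forall k, {within `[a, b], continuous z k}) ->
  (forall k t, t \in `]a, b[ -> is_derive t 1 (z k) (z k.+1 t)) ->
  (forall k t, t \in `[a, b] -> `|z k t| <= c ^+ k * B) ->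
  series (fun k => (b - a) ^+ k / k`!%:R * z k a) @ \oo --> z 0%N b.
Proof.
move=> ab c0 zc zd zB.
pose p k (t : R) : R := (b - t) ^+ k / k`!%:R.
have pd k (t : R) : is_derive t 1 (p k.+1) (- p k t).
  have -> : p k.+1 = (k.+1`!%:R)^-1 \*: ((cst b - id) ^+ k.+1).
    by apply/funext => u; rewrite /p mulrC exprfctE.
  apply: is_derive_eq; rewrite /p factS natrM /GRing.scale/= sub0r.
  have k0 : (k.+1%:R : R) != 0 by rewrite pnatr_eq0.
  have f0 : (k`!%:R : R) != 0 by rewrite pnatr_eq0 -lt0n fact_gt0.
  by rewrite -[(cst b - id) t]/(b - t); field; rewrite ?nat1r ?natr1 k0 f0.
have pc k : continuous (p k).
  case: k => [|k] t; first by rewrite /p; under eq_fun do rewrite expr0; exact: cvg_cst.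
  apply: differentiable_continuous.
  by apply/derivable1_diffP; have [] := pd k t.
pose F N (t : R) : R := \sum_(0 <= k < N.+1) p k t * z k t.
have FS N : F N.+1 = F N + (p N.+1 * z N.+1).
  by apply/funext => t; rewrite /F big_nat_recr.
have F0 : F 0%N = z 0%N.
  apply/funext => t; rewrite /F big_nat1 /p expr0 fact0 divr1.
  by rewrite mul1r.
have Fc N : {within `[a, b], continuous (F N)}.
  elim: N => [|N IH]; first by rewrite F0; exact: zc.
  rewrite FS => t; apply: continuousD; first exact: IH.
  apply: continuousM; last exact: zc.
  exact: continuous_subspaceT.
have Fd N t : t \in `]a, b[ -> is_derive t 1 (F N) (p N t * z N.+1 t).
  move=> tab; elim: N => [|N IH].
    by rewrite F0 /p expr0 fact0 divr1 mul1r; exact: zd.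
  rewrite FS.
  have H := is_deriveD IH (is_deriveM (pd N t) (zd N.+1 t tab)).
  by apply: (is_derive_eq H); rewrite /GRing.scale/=; ring.
have Fb N : F N b = z 0%N b.
  rewrite /F big_nat_recl// /p subrr expr0 fact0 divr1 mul1r big1 ?addr0// => k _.
  by rewrite exprS !mul0r.
have B0 : 0 <= B.
  have := zB 0%N a; rewrite in_itv/= lexx ab expr0 mul1r => /(_ isT).
  exact: le_trans.
have remainder_le M t : t \in `[a, b] -> `|p M t * z M.+1 t * (b - a)| <=
    c * B * (b - a) * exp_coeff ((b - a) * c) M.
  move=> tab; move: (tab); rewrite in_itv/= => /andP[at_ tb].
  rewrite (normrM (p M t * _)) (normrM (p M t)) (ger0_norm (_ : 0 <= b - a)) ?subr_ge0//.
  rewrite /exp_coeff/= exprMn.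
  have -> : c * B * (b - a) * ((b - a) ^+ M * c ^+ M / M`!%:R)
     = ((b - a) ^+ M / M`!%:R) * (c ^+ M.+1 * B) * (b - a) by rewrite exprS; ring.
  rewrite ler_wpM2r ?subr_ge0// ler_pM// ?zB//.
  rewrite /p normrM normfV normr_nat normrX ler_wpM2r ?invr_ge0// lerXn2r ?nnegrE//.
    by rewrite subr_ge0.
  by rewrite ger0_norm ?subr_ge0// lerB.
apply/cvgrPdist_le => e e0.
have : (fun N => c * B * (b - a) * exp_coeff ((b - a) * c) N) @ \oo --> 0.
  rewrite -[X in _ --> X](mulr0 (c * B * (b - a))).
  by apply: cvgMr; exact: cvg_exp_coeff.
move=> /cvgrPdist_le/(_ e e0) [N _ NP].
(* The Nth partial sum of a series has the terms of index below N, whereas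
   [F M] goes up to index M. *)
exists N.+1 => // -[//|M] /= NM; have {NP} := NP M NM.
rewrite sub0r normrN => HM.
have [t tab FE] := MVT_segment ab (Fd M) (Fc M).
have -> : series (fun k => (b - a) ^+ k / k`!%:R * z k a) M.+1 = F M a by [].
rewrite -(Fb M) FE.
apply: (le_trans _ (le_trans (ler_norm _) HM)).
exact: remainder_le.
Qed.

End Taylor.

Section Expmx.
Context {R : realType}.

(** Unlike the sup norm, this norm is submultiplicative, for rectangular matrices
too, so it can dominate the terms of the exponential series. *)
Definition l1norm m n (M : 'M[R]_(m, n)) : R := \sum_i \sum_j `|M i j|.

Lemma l1norm_ge0 m n (M : 'M[R]_(m, n)) : 0 <= l1norm M.
Proof. by apply: sumr_ge0 => i _; apply: sumr_ge0. Qed.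

Lemma normr_le_l1norm m n (M : 'M[R]_(m, n)) i j : `|M i j| <= l1norm M.
Proof.
rewrite /l1norm (bigD1 i)//= (bigD1 j)//= -addrA lerDl addr_ge0//.
  exact: sumr_ge0.
by apply: sumr_ge0 => k _; apply: sumr_ge0.
Qed.

Lemma l1norm_mulmx m n p (M : 'M[R]_(m, n)) (N : 'M[R]_(n, p)) :
  l1norm (M *m N) <= l1norm M * l1norm N.
Proof.
rewrite /l1norm mulr_suml; apply: ler_sum => i _.
apply: (@le_trans _ _ (\sum_k \sum_j `|M i j| * `|N j k|)).
  apply: ler_sum => k _; rewrite mxE (le_trans (ler_norm_sum _ _ _))//.
  by apply: ler_sum => j _; rewrite normrM.
rewrite exchange_big/= mulr_suml; apply: ler_sum => j _.
rewrite -mulr_sumr ler_wpM2l// (bigD1 j)//= lerDl.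
by apply: sumr_ge0 => k _; apply: sumr_ge0.
Qed.

(** The factor [N] makes room for [k = 0]: [l1norm 1%:M] is [n], which may
exceed [l1norm A ^+ 0]. *)
Lemma l1norm_expmul n p (A : 'M[R]_n) (N : 'M[R]_(n, p)) k :
  l1norm (A ^+ k *m N) <= l1norm A ^+ k * l1norm N.
Proof.
elim: k => [|k IH]; first by rewrite !expr0 mul1mx mul1r.
rewrite !exprS -mulmxE -mulmxA (le_trans (l1norm_mulmx _ _))// -mulrA.
by rewrite ler_wpM2l ?l1norm_ge0.
Qed.

(** [expmx] is defined as a limit that could fail to exist; here the entries of
the series are dominated by a scalar exponential series. *)
Lemma cvg_expmx n (A : 'M[R]_n) :
  series (fun k => (k`!%:R)^-1 *: A ^+ k) @ \oo --> expmx A.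
Proof.
set u := (X in series X).
have uij i j : cvgn (series (fun k => u k i j)).
  apply: normed_cvg.
  apply: (@series_le_cvg _ _ (fun k => l1norm (1%:M : 'M[R]_n) * exp_coeff (l1norm A) k)).
  - by move=> k /=.
  - by move=> k; rewrite mulr_ge0 ?exp_coeff_ge0 ?l1norm_ge0.
  - move=> k /=; rewrite /u mxE normrM ger0_norm ?invr_ge0 ?ler0n//.
    rewrite /exp_coeff/= mulrC mulrA ler_wpM2r ?invr_ge0 ?ler0n//.
    rewrite mulrC -[A ^+ k]mulmx1 (le_trans (normr_le_l1norm _ _ _))//.
    exact: l1norm_expmul.
  - by apply: is_cvg_seriesZ; exact: is_cvg_series_exp_coeff.
apply/cvg_ex; exists (\matrix_(i, j) limn (series (fun k => u k i j))).
apply/cvg_mxP => i j; rewrite mxE; apply: cvg_trans (uij i j).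
by apply: near_eq_cvg; near=> N; rewrite /series/= summxE.
Unshelve. all: by end_near. Qed.

Lemma trmxX n (A : 'M[R]_n) k : (A ^+ k)^T = A^T ^+ k.
Proof.
by elim: k => [|k IH]; rewrite ?expr0 ?trmx1// exprS exprSr -!mulmxE trmx_mul IH.
Qed.

Lemma expmx_tr n (A : 'M[R]_n) : expmx A^T = (expmx A)^T.
Proof.
have H : (fun N => (series (fun k => (k`!%:R)^-1 *: A ^+ k) N)^T) @ \oo
    --> (expmx A)^T by apply: cvg_trmx; exact: cvg_expmx.
rewrite -(cvg_lim _ H)//.
congr (limn _); apply/funext => N; rewrite /series/= linear_sum/=.
by apply: eq_bigr => k _; rewrite linearZ/= trmxX.
Qed.

Lemma exprmxZ n (c : R) (A : 'M[R]_n) k : (c *: A) ^+ k = c ^+ k *: A ^+ k.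
Proof.
elim: k => [|k IH]; first by rewrite !expr0 scale1r.
by rewrite !exprS IH -!mulmxE -scalemxAl -scalemxAr scalerA.
Qed.

(** The iterated derivatives of a solution [y] are the [A ^+ k *m y t], so its
Taylor series at [a], summed at [b], is the exponential series applied to
[y a]. *)
Lemma solves_on_expmx n (A : 'M[R]_n) (a b : R) (y : R -> 'cV[R]_n) : a <= b ->
  solves_on A a b y -> y b = expmx ((b - a) *: A) *m y a.
Proof.
move=> ab [yc yd].
have H : (fun N => series (fun k => (k`!%:R)^-1 *: ((b - a) *: A) ^+ k) N *m y a)
    @ \oo --> expmx ((b - a) *: A) *m y a.
  by apply: cvg_mulmx; [exact: cvg_expmx|exact: cvg_cst].
suff H' : (fun N => series (fun k => (k`!%:R)^-1 *: ((b - a) *: A) ^+ k) N *m y a)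
    @ \oo --> y b.
  exact: cvg_unique H' H.
apply/cvg_mxP => i j; rewrite {j}[j]ord1.
pose z k (t : R) : R := (A ^+ k *m y t) i 0.
have zc k : {within `[a, b], continuous (z k)}.
  move=> t; have : (fun t : subspace `[a, b] => A ^+ k *m y t) @ t --> A ^+ k *m y t.
    by apply: cvg_mulmx; [exact: cvg_cst|exact: yc].
  by move/cvg_mxP; apply.
have zd k t : t \in `]a, b[ -> is_derive t 1 (z k) (z k.+1 t).
  move=> /yd H1.
  have := is_derive_mulmx (is_derive_cst (A ^+ k : 'M[R]_n) t 1) H1.
  by rewrite mul0mx add0r mulmxA mulmxE -exprSr => /is_derive_mxP/(_ i 0).
have [B yB] : exists B, forall t, t \in `[a, b] -> l1norm (y t) <= B.
  have Nc : {within `[a, b], continuous (fun t => l1norm (y t))}.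
    move=> t; apply: cvg_big => [|k _]; first exact: add_continuous.
    apply: cvg_big => [|j _]; first exact: add_continuous.
    by apply: cvg_norm; have /cvg_mxP := yc t; exact.
  have [c _ cP] := EVT_max ab Nc.
  by exists (l1norm (y c)).
have zB k t : t \in `[a, b] -> `|z k t| <= l1norm A ^+ k * B.
  move=> /yB H1; rewrite (le_trans (normr_le_l1norm _ _ _))//.
  rewrite (le_trans (l1norm_expmul _ _ _))// ler_wpM2l//.
  by rewrite exprn_ge0// l1norm_ge0.
have := cvg_taylor ab (l1norm_ge0 A) zc zd zB.
rewrite {2}/z expr0 mul1mx; apply: cvg_trans.
apply: near_eq_cvg; near=> N; rewrite /series/= mulmx_suml summxE.
apply: eq_bigr => k _; rewrite exprmxZ scalerA -scalemxAl mxE /z.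
by rewrite [_^-1 * _]mulrC.
Unshelve. all: by end_near. Qed.

End Expmx.

(** * Positive definite forms and the Euclidean norm *)

Section PosDef.
Context {R : realType} {n : nat}.
Implicit Types (P : 'M[R]_n) (x w : 'cV[R]_n).

Lemma enorm_ge0 x : 0 <= enorm x. Proof. exact: sqrtr_ge0. Qed.

Lemma sqr_enorm x : enorm x ^+ 2 = \sum_i x i 0 ^+ 2.
Proof. by rewrite sqr_sqrtr// sumr_ge0// => i _; rewrite sqr_ge0. Qed.

Lemma normr_le_enorm x i : `|x i 0| <= enorm x.
Proof.
rewrite -(@ler_pXn2r _ 2)// ?nnegrE ?enorm_ge0// sqr_enorm real_normK ?num_real//.
by rewrite (bigD1 i)//= lerDl sumr_ge0// => j _; rewrite sqr_ge0.
Qed.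

Lemma qform_le_enorm P x : qform P x <= l1norm P * enorm x ^+ 2.
Proof.
rewrite /qform mxE /l1norm exchange_big/= mulr_suml; apply: ler_sum => j _.
rewrite mxE !mulr_suml; apply: ler_sum => i _.
rewrite mxE (le_trans (ler_norm _))// !normrM mulrAC mulrC expr2.
by rewrite ler_wpM2l// ler_pM// normr_le_enorm.
Qed.

Lemma posdefmx_qform_ge0 P x : posdefmx P -> 0 <= qform P x.
Proof.
move=> [_ P0]; have [->|/P0/ltW//] := eqVneq x 0.
by rewrite /qform mulmx0 mxE.
Qed.

Lemma posdefmx_unit P : posdefmx P -> P \in unitmx.
Proof.
move=> [_ P0]; rewrite unitmxE unitfE; apply/det0P => -[v v0 vP].
have /P0 : v^T != 0 by apply: contra v0 => /eqP v0; rewrite -[v]trmxK v0 trmx0.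
by rewrite trmxK vP mul0mx mxE ltxx.
Qed.

(** The form is nonnegative at [qform P w *: x - s *: w], which is
[qform P w] times the component of [x] that is [P]-orthogonal to [w]. *)
Lemma posdefmx_cauchy P w x : posdefmx P ->
  ((w^T *m P *m x) 0 0) ^+ 2 <= qform P w * qform P x.
Proof.
move=> PP; have [PT P0] := PP.
have [->|w0] := eqVneq w 0.
  by rewrite /qform trmx0 !mul0mx mxE expr0n/= mul0r.
have qw : 0 < qform P w by exact: P0.
set s := (w^T *m P *m x) 0 0.
have sE : (x^T *m P *m w) 0 0 = s.
  have -> : x^T *m P *m w = (w^T *m P *m x)^T.
    by rewrite !trmx_mul trmxK PT mulmxA.
  by rewrite mxE.
have := posdefmx_qform_ge0 (qform P w *: x - s *: w) PP.
have -> : qform P (qform P w *: x - s *: w)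
    = qform P w * (qform P w * qform P x - s ^+ 2).
  have BE (U V : 'M[R]_1) : (U - V) 0 0 = U 0 0 - V 0 0 by rewrite !mxE.
  have ZE (l : R) (U : 'M[R]_1) : (l *: U) 0 0 = l * U 0 0 by rewrite mxE.
  rewrite {1}/qform [(_ - _)^T]linearB/= ![(_ *: _)^T]linearZ/=.
  rewrite mulmxBl mulmxBr !mulmxBl -!scalemxAl -!scalemxAr.
  rewrite !(BE, ZE) sE -/s -/(qform P x) -/(qform P w).
  by ring.
by rewrite pmulr_rge0// subr_ge0.
Qed.

(** The coordinate [x i 0] is the [P]-inner product of [x] with the [i]th column
of [invmx P], so the Cauchy-Schwarz inequality bounds its square by a multiple
of [qform P x]. *)
Lemma enorm_le_qform P : posdefmx P ->
  exists2 c, 0 <= c & forall x, enorm x ^+ 2 <= c * qform P x.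
Proof.
move=> PP; pose w i := invmx P *m delta_mx i 0 : 'cV_n.
exists (\sum_i qform P (w i)).
  by apply: sumr_ge0 => i _; exact: posdefmx_qform_ge0.
move=> x; rewrite sqr_enorm mulr_suml; apply: ler_sum => i _.
have := posdefmx_cauchy (w i) x PP; congr (_ ^+ 2 <= _).
have -> : (w i)^T *m P = delta_mx 0 i.
  have [PT _] := PP.
  rewrite -[X in _ *m X]PT -trmx_mul mulmxA mulmxV ?mul1mx ?trmx_delta//.
  exact: posdefmx_unit.
by rewrite -rowE mxE.
Qed.

End PosDef.

(** * Signals between switching instants *)

Section SignalIntervals.
Context {R : realType} {M : nat}.
Implicit Types (sigma : R -> 'I_M).

(** The mean value theorem applies to the real indicator of the event
[sigma s = sigma a], whose derivative vanishes because the signal is locally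
constant. *)
Lemma signal_cst sigma (a b : R) :
  (\forall s \near a^'+, sigma s = sigma a) ->
  (forall t, t \in `]a, b[ -> \forall s \near t, sigma s = sigma t) ->
  forall t, t \in `[a, b[ -> sigma t = sigma a.
Proof.
move=> sa sab t; rewrite in_itv/= => /andP[]; rewrite le_eqVlt.
case/predU1P => [<-//|at_ tb].
pose g (s : R) : R := (sigma s == sigma a)%:R.
have gd s : s \in `]a, b[ -> is_derive s 1 g 0.
  move=> /sab sP; apply: (near_eq_is_derive (f := cst (g s))).
  by near=> u; rewrite /g (near sP u).
have gc : {within `[a, t], continuous g}.
  apply/(continuous_within_itvP _ at_); split.
  - move=> s; rewrite in_itv/= => /andP[as_ st].
    have /gd[sd _] : s \in `]a, b[ by rewrite in_itv/= as_ (lt_trans st).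
    exact/differentiable_continuous/derivable1_diffP.
  - apply: cvg_near_cst.
    by near=> u; rewrite /g (near sa u).
  - have /sab sP : t \in `]a, b[ by rewrite in_itv/= at_.
    apply: cvg_near_cst; apply: cvg_within.
    by near=> u; rewrite /g (near sP u).
have [s _] : exists2 s, s \in `]a, t[ & g t - g a = 0 * (t - a).
  apply: (MVT (df := cst 0) at_) gc => s.
  rewrite in_itv/= => /andP[as_ st]; apply: gd.
  by rewrite in_itv/= as_ (lt_trans st).
rewrite mul0r /g eqxx; case: eqP => // _ /eqP.
by rewrite sub0r oppr_eq0 oner_eq0.
Unshelve. all: by end_near. Qed.

(** Were the two modes equal, right continuity would make the signal constant on
both sides of [b], so [b] would not be a switching instant. *)
Lemma signal_switch sigma (a b : R) : signals sigma -> 0 <= a -> a < b ->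
  switching_instants sigma b ->
  (forall t, t \in `[a, b[ -> sigma t = sigma a) -> sigma a != sigma b.
Proof.
move=> [sr _] a0 ab [b0 nb] sab; apply/eqP => sE; apply: nb.
have {}sr : \forall s \near b, b < s -> sigma s = sigma b := sr b (ltW b0).
near=> s; have [sb|bs|<-//] := ltgtP s b; last exact: (near sr s).
by rewrite sab ?in_itv/= ?sb ?andbT//; apply/ltW; near: s; exact: lt_nbhsr.
Unshelve. all: by end_near. Qed.

End SignalIntervals.

Section Dwell.
Context {R : realType} {M : nat}.
Variables (sigma : R -> 'I_M) (t : nat -> R).
Hypothesis sigmaP : signals sigma.
Hypothesis t0 : t 0%N = 0.
Hypothesis tS : forall k, t k < t k.+1.
Hypothesis tE : range (fun k => t k.+1) = switching_instants sigma.

Let tmono : {mono t : i j / (i <= j)%N >-> i <= j}.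
Proof. exact: Order.NatMonotonyTheory.incnP tS. Qed.

Let tlt i j : (t i < t j) = (i < j)%N.
Proof. by rewrite !ltNge tmono -ltnNge. Qed.

Lemma switching_time_ge0 k : 0 <= t k.
Proof. by rewrite -t0 tmono. Qed.

Lemma not_switching k s : s \in `]t k, t k.+1[ -> ~ switching_instants sigma s.
Proof.
rewrite in_itv/= -tE => /andP[ks sk] [m _ ms]; move: ks sk.
by rewrite -ms !tlt !ltnS => km /(leq_ltn_trans km); rewrite ltnn.
Qed.

Lemma signal_dwell k s : s \in `[t k, t k.+1[ -> sigma s = sigma (t k).
Proof.
have [sr _] := sigmaP.
apply: signal_cst => [|u uk]; first exact: sr (switching_time_ge0 k).
apply: contrapT => nu; apply: (not_switching uk); split=> //.
move: uk; rewrite in_itv/= => /andP[ku _].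
exact: le_lt_trans (switching_time_ge0 k) ku.
Qed.

Lemma signal_jump k : sigma (t k) != sigma (t k.+1).
Proof.
apply: signal_switch => //; [exact: switching_time_ge0 | | exact: signal_dwell].
by rewrite -tE; exists k.
Qed.

(** Infinitely many switching instants below [T] would contradict the local
finiteness of a signal; [k] is then the first index with [T < t k.+1]. *)
Lemma dwell_cover T : 0 <= T -> exists k, t k <= T < t k.+1.
Proof.
move=> T0.
have [k Tk] : exists k, T < t k.+1.
  apply: contrapT => H.
  have tT k : t k.+1 <= T.
    by rewrite leNgt; apply/negP => kT; apply: H; exists k.
  have [_ /(_ T)] := sigmaP.
  rewrite -tE => /(finite_preimage (f := fun k => t k.+1)).
  have -> : (fun k => t k.+1) @^-1` (range (fun k => t k.+1) `&` [set s | s <= T])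
     = setT.
    by apply/seteqP; split=> // k _; split=> /=; [exists k | exact: tT].
  move=> fin; apply: infinite_nat; apply: fin => i j _ _ ij.
  by apply/eqP; rewrite -eqSS eqn_leq -!tmono ij lexx.
have := ex_minnP (ex_intro (fun k => T < t k.+1) k Tk) => -[m mT mmin].
exists m; rewrite mT andbT; case: m mT mmin => [_ _|m _ mmin]; first by rewrite t0.
by rewrite leNgt; apply/negP => /mmin; rewrite ltnn.
Qed.

End Dwell.

(** * From exit decay to exponential stability *)

Section Core.
Context {R : realType} {M n : nat}.
Variables (A : 'I_M -> 'M[R]_n) (rho tau1 tau2 mu nu : R).
Variables (Pp Pm : 'I_M -> 'M[R]_n).

(** What is needed from the last [tau1] units of time spent in mode [i] before a
switch to mode [j]. Both sets of matrix inequalities of the theorem are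
sufficient conditions for it. *)
Definition exit_decay : Prop := forall i j, i != j -> forall a y,
  solves_on (A i) a (a + tau1) y ->
  qform (Pm j) (y (a + tau1)) <= expR (- 2 * rho * tau1) * qform (Pp i) (y a).

Hypotheses (hrho : 0 < rho) (htau1 : 0 <= tau1).
Hypotheses (hPp : forall i, posdefmx (Pp i)) (hPm : forall i, posdefmx (Pm i)).
Hypotheses (hmu0 : 0 < mu) (hmu1 : mu < 1).
Hypothesis ha : forall i, loewner_le (Pp i) (mu ^+ 2 *: Pm i).
Hypothesis hb : forall i,
  loewner_le ((A i)^T *m Pp i + Pp i *m A i) ((2 * nu) *: Pp i).
Hypothesis hc : ln mu + (tau2 - tau1) * (nu + rho) <= 0.
Hypothesis hd : exit_decay.

(** The factor [mu ^+ 2] gained at the switch pays for the growth at rate [nu]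
during the surplus [s] of the dwell time over [tau1]. After taking logarithms
the claim is affine in [s], so it is enough to have it for [s = 0], where it is
[mu < 1], and for [s = tau2 - tau1]. *)
Lemma jump_compensates s : 0 <= s <= tau2 - tau1 ->
  expR (2 * nu * s) * mu ^+ 2 <= expR (- 2 * rho * s).
Proof.
move=> /andP[s0 s1].
have muE : mu = expR (ln mu) by rewrite lnK.
have lnmu : ln mu < 0 by apply: ln_lt0; rewrite hmu0.
rewrite muE -expRM_natl -expRD ler_expR.
have : ln mu + s * (nu + rho) <= 0.
  have [H|H] := lerP (nu + rho) 0.
    by have := mulr_ge0_le0 s0 H; lra.
  by apply: le_trans hc; rewrite lerD2l ler_wpM2r// ltW.
lra.
Qed.

(** Over one dwell interval: the entry jump from [Pm i] to [Pp i], then growth at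
rate [nu] until [b - tau1], then the exit phase from [Pp i] to [Pm j]. *)
Lemma dwell_step i j a b y : i != j -> tau1 <= b - a <= tau2 ->
  solves_on (A i) a b y ->
  qform (Pm j) (y b) <= expR (- 2 * rho * (b - a)) * qform (Pm i) (y a).
Proof.
move=> ij /andP[d1 d2] yab.
have ab' : a <= b - tau1 by lra.
have H1 : qform (Pm j) (y b) <=
    expR (- 2 * rho * tau1) * qform (Pp i) (y (b - tau1)).
  rewrite -[in leLHS](subrK tau1 b); apply: (hd ij).
  by apply: solves_onW yab => //; rewrite subrK.
have H2 : qform (Pp i) (y (b - tau1)) <=
    expR (2 * nu * (b - tau1 - a)) * qform (Pp i) (y a).
  apply: (lyapunov_decay_cst ab' _ (hb i)).
  by apply: solves_onW yab => //; rewrite gerBl.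
have H3 := loewner_le_qform (y a) (ha i); rewrite qformZ in H3.
have s01 : 0 <= b - tau1 - a <= tau2 - tau1 by apply/andP; split; lra.
apply: (le_trans H1).
have -> : - 2 * rho * (b - a) = - 2 * rho * tau1 + - 2 * rho * (b - tau1 - a) by ring.
rewrite expRD -[leRHS]mulrA ler_wpM2l ?expR_ge0//; apply: (le_trans H2).
apply: (@le_trans _ _ (expR (2 * nu * (b - tau1 - a)) * (mu ^+ 2 * qform (Pm i) (y a)))).
  by rewrite ler_wpM2l ?expR_ge0.
by rewrite mulrA ler_wpM2r ?posdefmx_qform_ge0// jump_compensates.
Qed.

(** At the switching instants the forms [Pm] decay at rate [2 * rho] by
[dwell_step]. Inside a dwell interval, which is no longer than [tau2], the form
[Pp] grows at most at rate [2 * nu], and the decay forgone is at most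
[expR (2 * rho * tau2)]; both losses go into the constant. *)
Lemma UES_exit_decay : UES A rho (dwell_signals tau1 tau2).
Proof.
have /choice[c cP] : forall i, exists c, 0 <= c /\
    forall x, enorm x ^+ 2 <= c * qform (Pp i) x.
  by move=> i; have [c c0 cP] := enorm_le_qform (hPp i); exists c.
pose C1 := \sum_i c i.
(* Summing over the modes makes the norm equivalence constants uniform. *)
have C1P i x : enorm x ^+ 2 <= C1 * qform (Pp i) x.
  have [_ /(_ x) H] := cP i; apply: (le_trans H).
  rewrite ler_wpM2r ?posdefmx_qform_ge0// /C1 (bigD1 i)//= lerDl.
  by apply: sumr_ge0 => j _; have [] := cP j.
pose C2 := \sum_i l1norm (Pm i).
have C2P i x : qform (Pm i) x <= C2 * enorm x ^+ 2.
  apply: (le_trans (qform_le_enorm _ _)).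
  rewrite ler_wpM2r ?sqr_ge0// /C2 (bigD1 i)//= lerDl.
  by apply: sumr_ge0 => j _; exact: l1norm_ge0.
have C10 : 0 <= C1 by apply: sumr_ge0 => j _; have [] := cP j.
have C20 : 0 <= C2 by apply: sumr_ge0 => j _; exact: l1norm_ge0.
pose E := expR ((`|nu| + rho) * tau2).
exists (Num.sqrt (C1 * C2) * E); first by rewrite mulr_ge0 ?sqrtr_ge0 ?expR_ge0.
move=> sigma x phi [sigmaP [t [t0 tS tE td]]] [phi0 phic phid] T T0.
have t_ge0 := switching_time_ge0 t0 tS.
have sol k : solves_on (A (sigma (t k))) (t k) (t k.+1) phi.
  split.
    apply: continuous_subspaceW phic => s /=; rewrite !in_itv/= andbT => /andP[ks _].
    exact: le_trans ks.
  move=> s sk; have := sk; rewrite in_itv/= => /andP[ks sk1].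
  rewrite -(signal_dwell sigmaP t0 tS tE (s := s)); last by rewrite in_itv/= ltW.
  apply: phid; first exact: le_lt_trans ks.
  exact: (not_switching tS tE sk).
pose V k := qform (Pm (sigma (t k))) (phi (t k)).
have VP k : V k <= expR (- 2 * rho * t k) * V 0%N.
  elim: k => [|k IH]; first by rewrite t0 mulr0 expR0 mul1r.
  apply: (le_trans (dwell_step (signal_jump sigmaP t0 tS tE k) (td k) (sol k))).
  have -> : - 2 * rho * t k.+1 = - 2 * rho * (t k.+1 - t k) + - 2 * rho * t k by ring.
  by rewrite expRD -[leRHS]mulrA ler_wpM2l ?expR_ge0.
have [k /andP[kT Tk]] := dwell_cover sigmaP t0 tS tE T0.
have /andP[_ dk] := td k.
set i := sigma (t k) in VP *.
have H1 : qform (Pp i) (phi T) <= expR (2 * nu * (T - t k)) * qform (Pp i) (phi (t k)).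
  apply: (lyapunov_decay_cst kT _ (hb i)).
  by apply: solves_onW (sol k) => //; exact: ltW.
have H2 : qform (Pp i) (phi (t k)) <= V k.
  apply: (le_trans (loewner_le_qform _ (ha i))); rewrite qformZ.
  by rewrite ler_piMl ?posdefmx_qform_ge0// expr_le1 ?ltW.
have V0 : V 0%N <= C2 * enorm x ^+ 2 by rewrite /V t0 phi0.
rewrite -(@ler_pXn2r _ 2)// ?nnegrE ?enorm_ge0 ?mulr_ge0 ?enorm_ge0 ?expR_ge0 ?sqrtr_ge0//.
apply: (le_trans (C1P i (phi T))).
rewrite !exprMn sqr_sqrtr ?mulr_ge0// /E -!expRM_natl.
have -> : C1 * C2 * expR (2 * ((`|nu| + rho) * tau2)) * expR (2 * (- rho * T)) * enorm x ^+ 2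
  = C1 * (expR (2 * ((`|nu| + rho) * tau2)) * expR (2 * (- rho * T)) * (C2 * enorm x ^+ 2)).
  by ring.
rewrite ler_wpM2l//; apply: (le_trans H1).
apply: (@le_trans _ _ (expR (2 * nu * (T - t k)) * (expR (- 2 * rho * t k) * (C2 * enorm x ^+ 2)))).
  rewrite ler_wpM2l ?expR_ge0//; apply: (le_trans H2); apply: (le_trans (VP k)).
  by rewrite ler_wpM2l ?expR_ge0.
rewrite [leLHS]mulrA ler_wpM2r ?mulr_ge0 ?enorm_ge0// -!expRD ler_expR.
have s0 : 0 <= T - t k by rewrite subr_ge0.
have s1 : T - t k <= tau2 by lra.
have nus : nu * (T - t k) <= `|nu| * tau2.
  apply: (@le_trans _ _ (`|nu| * (T - t k))); first by rewrite ler_wpM2r// ler_norm.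
  by rewrite ler_wpM2l.
have rhos : rho * (T - t k) <= rho * tau2 by rewrite ler_wpM2l// ltW.
lra.
Qed.

End Core.

(** * Two sufficient conditions for exit decay *)

Lemma exit_decay_expmx (R : realType) (M n : nat) (A : 'I_M -> 'M[R]_n)
    (rho tau1 : R) (Pp Pm : 'I_M -> 'M[R]_n) : 0 <= tau1 ->
  (forall i j, i != j ->
    loewner_le (expmx (tau1 *: (A i)^T) *m Pm j *m expmx (tau1 *: A i))
               (expR (- 2 * rho * tau1) *: Pp i)) ->
  exit_decay A rho tau1 Pp Pm.
Proof.
move=> tau1_ge0 lmi i j ij a y yA.
have -> : y (a + tau1) = expmx (tau1 *: A i) *m y a.
  have ab : a <= a + tau1 by rewrite lerDl.
  by rewrite (solves_on_expmx ab yA) addrC addKr.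
rewrite -qform_conj -expmx_tr linearZ/= -qformZ.
exact/loewner_le_qform/lmi.
Qed.

(** The exit phase is cut into [K] steps of length [tau1 / K]; on the [k]th one
the interpolation from [Q k] to [Q k.+1] decays at rate [2 * rho], and the
steps are chained. *)
Lemma exit_decay_interpolation (R : realType) (M n : nat)
    (A : 'I_M -> 'M[R]_n) (rho tau1 : R) (Pp Pm : 'I_M -> 'M[R]_n) (K : nat) :
  0 < tau1 -> (0 < K)%N ->
  (forall i j, i != j -> exists Q : nat -> 'M[R]_n,
    [/\ Q 0%N = Pp i, Q K = Pm j &
      forall k, (k < K)%N ->
        loewner_le ((A i)^T *m Q k + Q k *m A i
                      + (K%:R / tau1) *: (Q k.+1 - Q k))
                   ((- 2 * rho) *: Q k) /\
        loewner_le ((A i)^T *m Q k.+1 + Q k.+1 *m A i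
                      + (K%:R / tau1) *: (Q k.+1 - Q k))
                   ((- 2 * rho) *: Q k.+1)]) ->
  exit_decay A rho tau1 Pp Pm.
Proof.
move=> tau1_gt0 K_gt0 lmi i j ij a y yA.
have [Q [Q0 QK lmiQ]] := lmi i j ij.
pose h := tau1 / K%:R.
have h_gt0 : 0 < h by rewrite divr_gt0 ?ltr0n.
have Kh : K%:R * h = tau1 by rewrite mulrC divfK// pnatr_eq0 -lt0n.
rewrite -Q0 -QK -Kh.
suff: forall k, (k <= K)%N -> qform (Q k) (y (a + k%:R * h)) <=
    expR (- 2 * rho * (k%:R * h)) * qform (Q 0%N) (y a).
  by move=> /(_ K (leqnn K)).
elim=> [_|k IH kK]; first by rewrite mul0r addr0 mulr0 expR0 mul1r.
have step : a + k.+1%:R * h - (a + k%:R * h) = h by rewrite -natr1; ring.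
have hV : h^-1 = K%:R / tau1 by rewrite invf_div.
have lt_step : a + k%:R * h < a + k.+1%:R * h by rewrite -subr_gt0 step.
have [lP lQ] := lmiQ k kK.
have -> : - 2 * rho * (k.+1%:R * h) = - 2 * rho * h + - 2 * rho * (k%:R * h).
  by rewrite -natr1; ring.
rewrite expRD -[leRHS]mulrA.
apply: le_trans (_ : expR (- 2 * rho * h) * qform (Q k) (y (a + k%:R * h)) <= _).
  have := @lyapunov_decay_segment _ _ (A i) (Q k) (Q k.+1) y (- 2 * rho) _ _ lt_step.
  rewrite step hV; apply=> //.
  apply: solves_onW yA; first by rewrite lerDl mulr_ge0// ltW.
  by rewrite lerD2l -Kh ler_wpM2r ?(ltW h_gt0)// ler_nat.
by rewrite ler_wpM2l ?expR_ge0// IH// ltnW.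
Qed.

Theorem corollary3 (R : realType) (M n : nat) (A : 'I_M -> 'M[R]_n)
    (rho tau1 tau2 : R) (hrho : 0 < rho) (htau1 : 0 <= tau1)
    (htau : tau1 <= tau2)
    (Pp Pm : 'I_M -> 'M[R]_n) (mu nu : R)
    (hPp : forall i, posdefmx (Pp i)) (hPm : forall i, posdefmx (Pm i))
    (hmu0 : 0 < mu) (hmu1 : mu < 1)
    (ha : forall i, loewner_le (Pp i) (mu ^+ 2 *: Pm i))
    (hb : forall i,
      loewner_le ((A i)^T *m Pp i + Pp i *m A i) ((2 * nu) *: Pp i))
    (hc : ln mu + (tau2 - tau1) * (nu + rho) <= 0) :
  ((forall i j, i != j ->
      loewner_le (expmx (tau1 *: (A i)^T) *m Pm j *m expmx (tau1 *: A i))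
                 (expR (- 2 * rho * tau1) *: Pp i)) ->
    UES A rho (dwell_signals tau1 tau2))
  /\
  (0 < tau1 ->
    forall K : nat, (1 <= K)%N ->
    (forall i j, i != j ->
      exists Q : nat -> 'M[R]_n,
        [/\ (forall k, (k <= K)%N -> posdefmx (Q k)),
            Q 0%N = Pp i,
            Q K = Pm j &
            forall k, (1 <= k <= K)%N ->
              loewner_lt ((A i)^T *m Q k + Q k *m A i
                            + (K%:R / tau1) *: (Q k - Q k.-1))
                         ((- 2 * rho) *: Q k) /\
              loewner_lt ((A i)^T *m Q k.-1 + Q k.-1 *m A i
                            + (K%:R / tau1) *: (Q k - Q k.-1))
                         ((- 2 * rho) *: Q k.-1)]) ->
    UES A rho (dwell_signals tau1 tau2)).
Proof.
split=> [lmi|tau1_gt0 K K_gt0 lmi];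
  apply: (UES_exit_decay hrho htau1 hPp hPm hmu0 hmu1 ha hb hc).
  exact: exit_decay_expmx.
apply: (exit_decay_interpolation tau1_gt0 K_gt0) => i j /lmi[Q [_ Q0 QK lmiQ]].
exists Q; split=> // k kK; have [lQ lP] := lmiQ k.+1 kK.
by split; exact: loewner_lt_le.
Qed.
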